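(* Assume that $\{x_t\}_{t=0}^{\infty}\subset C$ is a sequence such that for each integer $t\ge 0$, $x_{t+1}\in T(x_t)$. Then there exist $x_*=\lim_{t\to\infty}x_t$ and a natural number $t_0$ such that for each integer $t\ge t_0$, $\phi(x_t)\subset\phi(x_* )$, and if an integer $i\in\phi(x_t)$ satisfies $x_{t+1}=T_i(x_t)$, then $T_i(x_* )=x_*$.
   Context: Let $(X,\rho)$ be a metric space, $C\subset X$ a nonempty closed set, and fix $\theta\in C$. For $x\in X$ and $r>0$ put $B(x,r)=\{y\in X:\rho(x,y)\le r\}$. For an operator $S:C\to C$ put $\mathrm{Fix}(S)=\{x\in C: S(x)=x\}$. Let $m$ be a natural number, let $T_i:C\to C$, $i=1,\dots,m$, be continuous operators, and let $\phi:X\to 2^{\{1,\dots,m\}}\setminus\{\emptyset\}$ assign to each point $x \in X$ a nonempty subset $\phi(x)\subset\{1,\dots,m\}$. The following standing assumptions hold. (A1) For each $M>0$ the set $B(\theta,M)\cap C$ is compact. (A2) For every $i\in\{1,\dots,m\}$, every $z\in\mathrm{Fix}(T_i)$, every $x\in C$ and every $y\in C\setminus\mathrm{Fix}(T_i)$, we have $\rho(z,T_i(x))\le\rho(z,x)$ and $\rho(z,T_i(y))<\rho(z,y)$. (A3) For each $x\in C$ there exists $\delta>0$ such that for each $y\in B(x,\delta)\cap C$, $\phi(y)\subset\phi(x)$. For $x\in C$ define the set $T(x)=\{T_i(x): i\in\phi(x)\}$. Put $\bar F(T)=\{z\in C: T_i(z)=z,\ i=1,\dots,m\}$; it is assumed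 that $\bar F(T)\neq\emptyset$. *)

(* Defs.v *)
From HB Require Import structures.
From mathcomp Require Import all_boot all_order all_algebra.
From mathcomp Require Import all_classical all_reals all_analysis.

Set Implicit Arguments.
Unset Strict Implicit.
Unset Printing Implicit Defensive.

Import Order.TTheory GRing.Theory Num.Theory.

Local Open Scope classical_set_scope.
Local Open Scope ring_scope.

(* Unlike the library's [closed_ball], this is not the closure of the open
   ball, which can be strictly smaller in a general metric space. *)
Definition metric_ball (R : realType) (X : metricType R) (x : X) (r : R)
  : set X := [set y | mdist x y <= r].

(* An operator C -> C is represented by a function X -> X that maps C to C;
   its values outside C are irrelevant. *)
Definition fixed_points (X : Type) (C : set X) (S : X -> X) : set X :=
  [set x | C x /\ S x = x].

Definition set_valued_map (X I : Type) (T : I -> X -> X) (phi : X -> set I)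
  (x : X) : set X := [set T i x | i in phi x].

Definition common_fixed_points (X I : Type) (C : set X) (T : I -> X -> X)
  : set X := [set z | C z /\ forall i, T i z = z].

(* Main.v *)
(* Distances from the orbit to a common fixed point z are nonincreasing, so the
   orbit is bounded and has a cluster point p, with d(z, p) <= d(z, x_t) for all
   t.  If T_i p <> p then d(z, T_i p) < d(z, p), hence d(z, T_i y) < d(z, p)
   for y in C near p, and such a y = x_t cannot satisfy x_(t+1) = T_i y.  So near p
   only operators fixing p are used; they do not increase the distance to p, the
   orbit never leaves a small ball around p once inside it, and it converges to
   p. *)
Require Import Defs.
From HB Require Import structures.
From mathcomp Require Import all_boot all_order all_algebra.
From mathcomp Require Import all_classical all_reals all_analysis.

Import Order.TTheory GRing.Theory Num.Theory.

Local Open Scope classical_set_scope.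
Local Open Scope ring_scope.

(** Every tail of the sequence belongs to the filter [x @ \oo], so it meets each ball around a
    cluster point. *)
Lemma cluster_seq_mdist (R : realType) (X : metricType R) (x : nat -> X) (p : X)
  (t : nat) (e : R) :
  cluster (x @ \oo) p -> 0 < e -> exists2 s, (t <= s)%N & mdist p (x s) < e.
Proof.
move=> clp e0.
have Ft : (x @ \oo) [set x s | s in [set s | (t <= s)%N]].
  by exists t => // s /= ts; exists s.
have [_ [[s /= ts <-] ps]] := clp _ _ Ft (nbhsx_ballx p e e0).
by exists s => //; move: ps; rewrite ballEmdist.
Qed.

Lemma mdist_nonincreasing_cluster_cvg (R : realType) (X : metricType R)
  (x : nat -> X) (p : X) (r : R) : 0 < r -> cluster (x @ \oo) p ->
  (forall t, mdist p (x t) < r -> mdist p (x t.+1) <= mdist p (x t)) ->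
  x t @[t --> \oo] --> p.
Proof.
move=> r0 clp step; apply/cvg_ballP => e e0.
(* Staying below [r] keeps [step] applicable, staying below [e] gives convergence; the induction
   preserves both bounds. *)
have [s _ ps] : exists2 s, (0 <= s)%N & mdist p (x s) < Num.min r e.
  by apply: cluster_seq_mdist => //; rewrite lt_min r0.
exists s => // t /= st; rewrite ballEmdist/=.
suff : mdist p (x t) < Num.min r e by rewrite lt_min => /andP[].
rewrite -(subnKC st); elim: (t - s)%N => [|k IHk]; first by rewrite addn0.
rewrite addnS (le_lt_trans _ IHk)// step//.
by move: IHk; rewrite lt_min => /andP[].
Qed.

Lemma le_mdist_cluster (R : realType) (X : metricType R) (x : nat -> X)
  (z p : X) : {homo (fun t => mdist z (x t)) : s t / (s <= t)%N >-> t <= s} ->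
  cluster (x @ \oo) p -> forall t, mdist z p <= mdist z (x t).
Proof.
move=> noninc clp t; apply/ler_addgt0Pl => e e0.
have [s ts ps] := cluster_seq_mdist _ _ _ _ t _ clp e0.
rewrite (le_trans (metric_triangle z (x s) p))// addrC lerD ?noninc//.
by rewrite metric_sym ltW.
Qed.

Theorem theorem2p2 (R : realType) (X : metricType R) (C : set X) (theta : X)
  (m : nat) (T : 'I_m -> X -> X) (phi : X -> set 'I_m)
  (C_neq0 : C !=set0) (C_closed : closed C) (C_theta : C theta)
  (T_maps : forall i, set_fun C C (T i))
  (T_cont : forall i, {within C, continuous (T i)})
  (phi_neq0 : forall x, phi x !=set0)
  (A1 : forall M : R, 0 < M -> compact (metric_ball theta M `&` C))
  (A2 : forall i z, fixed_points C (T i) z ->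
    (forall x, C x -> mdist z (T i x) <= mdist z x) /\
    (forall y, (C `\` fixed_points C (T i)) y ->
      mdist z (T i y) < mdist z y))
  (A3 : forall x, C x -> exists2 delta : R, 0 < delta &
    forall y, (metric_ball x delta `&` C) y -> phi y `<=` phi x)
  (F_neq0 : common_fixed_points C T !=set0)
  (x : nat -> X) (x_in_C : forall t, C (x t))
  (x_step : forall t, set_valued_map T phi (x t) (x t.+1)) :
  exists xstar : X, [/\ C xstar, x t @[t --> \oo] --> xstar &
    exists t0 : nat, forall t : nat, (t0 <= t)%N ->
      phi (x t) `<=` phi xstar /\
      (forall i, phi (x t) i -> x t.+1 = T i (x t) -> T i xstar = xstar)].
Proof.
have [z [Cz Fz]] := F_neq0.
have step_le y i t : fixed_points C (T i) y -> x t.+1 = T i (x t) ->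
    mdist y (x t.+1) <= mdist y (x t).
  by move=> /A2[+ _] ->; apply.
have noninc : {homo (fun t => mdist z (x t)) : s t / (s <= t)%N >-> t <= s}.
  apply: (homo_leq (r := fun a b : R => b <= a)) => [a|b a c ab bc|t].
  - exact: lexx.
  - exact: le_trans bc ab.
  - by have [i _ ixt] := x_step t; apply: step_le (esym ixt).
(* The first two terms bound the distance from [theta] to the orbit, going through [z]; the 1 makes
   [M] positive. *)
pose M := mdist theta z + mdist z (x 0%N) + 1.
have M0 : 0 < M by rewrite ltr_wpDl// addr_ge0// mdist_ge0.
have [p [[_ Cp] clp]] :
    (metric_ball theta M `&` C) `&` cluster (x @ \oo) !=set0.
  apply: A1 => //; exists 0%N => // t _ /=; split => //.
  rewrite /metric_ball/= (le_trans (metric_triangle _ z _))// /M -addrA lerD2l.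
  by rewrite (le_trans (noninc 0%N t _))// lerDl.
have zp := le_mdist_cluster _ _ _ _ _ noninc clp.
(* A single neighbourhood serves all [i] because there are finitely many operators. The premise
   [C y] reflects continuity within [C] only. *)
have near_fix : \forall y \near p, forall i, C y ->
    mdist z (T i y) < mdist z p \/ T i p = p.
  apply: filter_forall => i.
  have [Tp|Tp] := pselect (T i p = p); first by apply: nearW => y _; right.
  have lt_zp : mdist z (T i p) < mdist z p.
    by have [_] := A2 i z (conj Cz (Fz i)); apply; split => // -[].
  have := (subspace_continuousP _ _).1 (T_cont i) p Cp.
  (* This radius is exactly the slack that the triangle inequality through [T i p] may use up. *)
  move=> /cvg_ballP /(_ (mdist z p - mdist z (T i p))).
  rewrite subr_gt0 => /(_ lt_zp); rewrite nearE /within/=.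
  apply: filterS => y + Cy => /(_ Cy); rewrite ballEmdist/= => Ty; left.
  by rewrite (le_lt_trans (metric_triangle _ (T i p) _))// -ltrBrDl.
have [r /= r0 near_r] := (nbhs_ballP _ _).1 near_fix.
have fixp i t : mdist p (x t) < r -> x t.+1 = T i (x t) -> T i p = p.
  move=> ptr xt; have := near_r (x t); rewrite ballEmdist => /(_ ptr i).
  (* The strict alternative would put [x t.+1] closer to [z] than [p] is, against [zp]. *)
  by move=> /(_ (x_in_C t))[|//]; rewrite -xt ltNge zp.
have xp : x t @[t --> \oo] --> p.
  apply: (mdist_nonincreasing_cluster_cvg _ _ _ _ _ r0 clp) => t ptr.
  have [i _ ixt] := x_step t.
  by apply: step_le (esym ixt); split=> //; apply: fixp (esym ixt).
have [d d0 phi_d] := A3 p Cp.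
exists p; split=> //.
(* Within [r] of [p] the operators used fix [p]; within [d], [A3] gives the inclusion of index
   sets. *)
have rd0 : 0 < Num.min r d by rewrite lt_min r0.
have [t0 _ near_t0] := (cvg_ballP _ _).1 xp _ rd0.
exists t0 => t t0t; have := near_t0 t t0t.
rewrite ballEmdist/= lt_min => /andP[ptr ptd]; split=> [|i _]; last exact: fixp.
by apply: phi_d; split=> //; exact: ltW.
Qed.
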